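(* Fix an integer $d\ge2$ and $c>0$. For each $n$ let $\mathbf p=\mathbf p(n)=(p_1,\dots,p_d)\in(0,1]^d$, and let $Y=Y_d(n,\mathbf p)$. Suppose the sequence $(Y_d(n,\mathbf p))_n$ belongs to $\operatorname{Dom}(c)$. Then $$\frac{|Y^{d-1}|}{\binom nd}\to c\quad\text{in probability as } n\to\infty.$$
   Context: The model $Y_d(n,\mathbf p)$ (multi-parameter random simplicial complex): the vertex set is $[n]=\{1,\dots,n\}$. Let $\chi_\tau=\chi_\tau^{(n)}$, for $\tau\subseteq[n]$ with $2\le|\tau|\le d+1$, be independent Bernoulli random variables with parameter $p_{|\tau|-1}$; then $Y_d(n,\mathbf p)$ is the set of all $\sigma\subseteq[n]$ with $|\sigma|\le d+1$ such that $\chi_\tau=1$ for every $\tau\subseteq\sigma$ with $|\tau|\ge2$. (Equivalently, starting from $n$ vertices, for $k=1,\dots,d$ in turn, every $k$-cell whose boundary is already present is included independently with probability $p_k$.) A $j$-cell is an element of the complex of cardinality $j+1$, and $Y^{j}$ is the set of $j$-cells of $Y$. For $c>0$, the sequence $(Y_d(n,\mathbf p))_n$ belongs to $\operatorname{Dom}(c)$ if, as $n\to\infty$, $\min_{i=1,\dots,d-1}\liminf p_i>0$, $np_d(1-p_d)\to\infty$, and $\prod_{i=1}^{d-1}p_i^{\binom{d}{i+1}}\to c$. *)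

(* Defs.v *)
From HB Require Import structures.
From mathcomp Require Import all_boot all_order all_algebra.
From mathcomp Require Import all_classical all_reals all_analysis.

Set Implicit Arguments.
Unset Strict Implicit.
Unset Printing Implicit Defensive.

Import Order.TTheory GRing.Theory Num.Theory.
Import numFieldNormedType.Exports.

Local Open Scope ring_scope.

Section Probability.
Local Open Scope classical_set_scope.

(* Only the subfamily [X i], [i \in D], is concerned. *)
Definition mutually_independent (R : realType) (dO : measure_display)
    (Omega : measurableType dO) (P : probability Omega R)
    (dT : measure_display) (T : measurableType dT)
    (I : finType) (D : {set I}) (X : I -> {RV P >-> T}) : Prop :=
  forall (J : {set I}) (B : I -> set T),
    J \subset D ->
    (forall i, i \in J -> measurable (B i)) ->
    P (\bigcap_(i in [set` J]) (X i @^-1` B i)) =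
      (\prod_(i in J) P (X i @^-1` B i))%E.

(* The n-th variable lives on its own probability space, as is natural when
   the limit is a constant. *)
Definition cvg_in_probability_to_cst (R : realType) (dO : nat -> measure_display)
    (Omega : forall n, measurableType (dO n))
    (P : forall n, probability (Omega n) R)
    (X : forall n, Omega n -> R) (c : R) : Prop :=
  forall eps : R, 0 < eps ->
    (fun n => P n [set w | eps < `|X n w - c|]) @ \oo --> 0%E.

End Probability.

(* The subsets tau with 2 <= |tau| <= d+1, which carry a Bernoulli variable. *)
Definition potential_faces (d n : nat) : {set {set 'I_n}} :=
  [set tau : {set 'I_n} | (2 <= #|tau| <= d.+1)%N].

(* [p k] is the parameter of the k-cells; only [p 1], ..., [p d] matter, and
   [chi] is constrained on [potential_faces d n] only. *)
Definition bernoulli_face_family (R : realType) (d n : nat) (p : nat -> R)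
    (dO : measure_display) (Omega : measurableType dO)
    (P : probability Omega R) (chi : {set 'I_n} -> {RV P >-> bool}) : Prop :=
  mutually_independent (potential_faces d n) chi /\
  (forall tau, tau \in potential_faces d n ->
     forall A : set bool,
       distribution P (chi tau) A = bernoulli_prob (p #|tau|.-1) A).

(* The complex Y_d(n, p) determined by one outcome [x] of the Bernoulli
   variables. As in the model, the empty set belongs to it. *)
Definition Yd (d n : nat) (x : {set 'I_n} -> bool) : {set {set 'I_n}} :=
  [set sigma : {set 'I_n} | (#|sigma| <= d.+1)%N &&
     [forall tau : {set 'I_n},
        (tau \subset sigma) && (2 <= #|tau|)%N ==> x tau]].

Definition cells (n j : nat) (Y : {set {set 'I_n}}) : {set {set 'I_n}} :=
  [set sigma in Y | #|sigma| == j.+1].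

(* [p n i] is the parameter p_i of the n-th complex. *)
Definition Dom (R : realType) (d : nat) (c : R) (p : nat -> nat -> R) : Prop :=
  [/\ (0 < \big[Order.min/+oo]_(1 <= i < d)
             limn_einf (fun n => (p n i)%:E))%E,
      ((fun n => n%:R * p n d * (1 - p n d)) @ \oo --> +oo)%classic
    & ((fun n => \prod_(1 <= i < d) p n i ^+ 'C(d, i.+1)) @ \oo --> c)%classic].

(* Main.v *)
Require Import Defs.
From HB Require Import structures.
From mathcomp Require Import all_boot all_order all_algebra.
From mathcomp Require Import all_classical all_reals all_analysis.
From mathcomp Require Import measurable_realfun.
From mathcomp Require Import ring lra.
Import Order.TTheory GRing.Theory Num.Theory.
Import numFieldNormedType.Exports.
Local Open Scope ring_scope.

(** The proof is a second moment argument. The number of (d-1)-cells is the sum,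
    over the d-subsets s of the vertex set, of the indicator of the event that
    every face of s with at least two vertices is retained. Each of these events
    has the same probability q, the product of the p_i ^ C(d, i+1) for
    0 < i < d, because a d-set has C(d, i+1) faces of dimension i
    ([prob_present]).

    Two disjoint d-sets share no nonempty face, so their events are independent
    and contribute nothing to the variance ([prob_presentI]); every other ordered
    pair contributes at most 1. The pairs that meet are few: counting them
    through a common vertex gives at most n C(n-1, d-1)^2 = d^2 C(n, d)^2 / n of
    them ([card_meeting_pairs]). Chebyshev's inequality
    ([chebyshev_count]) therefore bounds by d^2 / (n eps^2) the probability that
    the density of (d-1)-cells is at distance at least eps from q
    ([density_deviation]). This tends to 0 uniformly in the parameters, and q
    tends to c by the third condition defining Dom(c).

    Pairs sharing exactly one vertex are in fact independent too; treating them
    as dependent costs a factor n in the bound and makes the count of exceptional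
    pairs a plain union bound over vertices. *)

Set Implicit Arguments.
Unset Strict Implicit.

(** * Chebyshev's inequality for the number of events that occur *)

Section CountingEvents.
Context {dT : measure_display} {T : measurableType dT} {R : realType}
  (P : probability T R).
Local Open Scope classical_set_scope.

Lemma indic_Lfun (A : set T) (r : R) :
  1 <= r -> measurable A -> (\1_A : T -> R) \in Lfun P r%:E.
Proof.
move=> r1 mA.
rewrite inE; apply/andP; split; first by rewrite inE /=; exact: measurable_indic.
rewrite inE /= /finite_norm unlock poweR_lty//.
under eq_integral => x _.
  rewrite (_ : `|(EFin \o \1_A) x| `^ r = (\1_A x)%:E)%E; last first.
    rewrite /= indicE; case: (_ \in _) => /=.
      by rewrite normr1 powR1.
    by rewrite normr0 powR0// gt_eqF// (lt_le_trans ltr01).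
  over.
by rewrite integral_indic// setIT (le_lt_trans (probability_le1 _ mA))// ltry.
Qed.

Lemma expectation_sum_indic (I : finType) (S : {set I}) (A : I -> set T) :
  (forall i, measurable (A i)) ->
  ('E_P[\sum_(i in S) \1_(A i)] = \sum_(i in S) P (A i))%E.
Proof.
move=> mA; rewrite -big_enum -(big_map (fun i => \1_(A i) : T -> R) xpredT id).
rewrite expectation_sum; last by move=> _ /mapP[i _ ->]; exact: indic_Lfun.
rewrite big_map big_enum; apply: eq_bigr => i _; exact: expectation_indic.
Qed.

(** The variance of the number of events that occur is the sum over ordered
    pairs of P(A_i and A_j) - q^2, in which only the pairs of the exceptional
    set [B] survive, each contributing at most 1. *)
Lemma chebyshev_count (I : finType) (S : {set I}) (B : {set I * I})
    (A : I -> set T) (q eps : R) :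
  (forall i, measurable (A i)) ->
  (forall i, i \in S -> P (A i) = q%:E) ->
  (forall i j, i \in S -> j \in S -> (i, j) \notin B ->
     P (A i `&` A j) = (q ^+ 2)%:E) ->
  0 < eps ->
  (P [set w | (eps <= `| \sum_(i in S) \1_(A i) w - #|S|%:R * q |)%R]
     <= (#|B|%:R / eps ^+ 2)%:E)%E.
Proof.
move=> mA PA PAA eps0.
pose X : T -> R := \sum_(i in S) \1_(A i).
have X2 : X \in Lfun P 2%:E.
  have [L0 LD] := @Lfun_addr_closed _ _ _ P 2%:E (lee1n 2).
  rewrite /X; elim/big_ind: _ => //.
  by move=> i _; apply: indic_Lfun => //; rewrite ler1n.
have mX : X \in mfun by exact: sub_Lfun_mfun X2.
have EX : ('E_P[X] = (#|S|%:R * q)%:E)%E.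
  rewrite expectation_sum_indic// (eq_bigr _ PA) sumEFin sumr_const.
  by rewrite mulr_natl.
have XE w : X w = \sum_(i in S) \1_(A i) w by rewrite /X fct_sumE.
have EX2 : ('E_P[X ^+ 2] <= (#|B|%:R + (#|S|%:R * q) ^+ 2)%:E)%E.
  have -> : X ^+ 2 = \sum_(ij in finset.setX S S) \1_(A ij.1 `&` A ij.2).
    apply/funext => w.
    rewrite fct_sumE; transitivity (X w * X w); first by [].
    rewrite XE big_distrlr /= pair_big /=.
    by apply: eq_big => [[i j]|ij _]; rewrite ?finset.in_setX ?indicI.
  rewrite (@expectation_sum_indic _ (finset.setX S S)
    (fun ij => A ij.1 `&` A ij.2)); last by move=> i; exact: measurableI.
  have bound ij : ij \in finset.setX S S ->
      (P (A ij.1 `&` A ij.2) <= ((ij \in B)%:R + q ^+ 2)%:E)%E.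
    case: ij => i j; rewrite finset.in_setX /= => /andP[iS jS].
    have [_|ijB] := boolP ((i, j) \in B); last by rewrite PAA// add0r.
    apply: le_trans (probability_le1 _ (measurableI _ _ (mA i) (mA j))) _.
    by rewrite lee_fin lerDl sqr_ge0.
  apply: le_trans (lee_sum _ bound) _.
  rewrite sumEFin lee_fin big_split /= sumr_const finset.cardsX.
  rewrite exprMn -natrX mulr_natl mulnn lerD2r -natr_sum ler_nat.
  rewrite -big_mkcondr /= sum1_card.
  by apply/subset_leq_card/fintype.subsetP => ij; rewrite unfold_in => /andP[].
have := @chebyshev _ _ _ P (mfun_Sub mX) eps eps0.
rewrite mfun_valP EX /=.
under eq_set => w do rewrite XE.
move/le_trans; apply.
rewrite [_ / _]mulrC EFinM lee_pmul2l ?lte_fin ?invr_gt0 ?exprn_gt0//.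
by rewrite varianceE// EX leeBlDr.
Qed.

End CountingEvents.

(** * Faces of a d-set and pairs of d-sets that meet *)

Section Counting.

(** The faces of [s] that carry a Bernoulli variable: vertices and the empty
    face are always present. *)
Definition faces {n : nat} (s : {set 'I_n}) : {set {set 'I_n}} :=
  [set tau : {set 'I_n} | (tau \subset s) && (1 < #|tau|)%N].

Definition subsets (n d : nat) : {set {set 'I_n}} :=
  [set s : {set 'I_n} | #|s| == d].

Lemma card_subsets (n d : nat) : #|subsets n d| = 'C(n, d).
Proof. by rewrite card_draws card_ord. Qed.

(** Grouping the faces of a d-set by dimension i: there are C(d, i+1) of them. *)
Lemma prod_faces (R : comPzRingType) (d n : nat) (p : nat -> R)
    (s : {set 'I_n}) :
  s \in subsets n d ->
  \prod_(tau in faces s) p #|tau|.-1 =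
    \prod_(1 <= i < d) p i ^+ 'C(d, i.+1).
Proof.
rewrite inE => /eqP; case: d => [|d] sd.
  rewrite big_geq// big1// => tau; rewrite inE => /andP[ts].
  by rewrite ltnNge (leq_trans (subset_leq_card ts))// sd.
rewrite big_geq_mkord.
have dim tau : tau \in faces s -> (#|tau|.-1 < d.+1)%N && (1 <= #|tau|.-1)%N.
  rewrite inE => /andP[/subset_leq_card]; rewrite sd.
  by case: #|tau| => [|[|m]]//= ->.
rewrite (partition_big (fun tau : {set 'I_n} => inord #|tau|.-1 : 'I_d.+1)
  (fun i => 1 <= i)%N) /=; last first.
  by move=> tau /dim/andP[td t1]; rewrite inordK.
apply: eq_bigr => i i1.
have -> : 'C(d.+1, i.+1) =
    #|[set tau : {set 'I_n} | tau \subset s & #|tau| == i.+1]|.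
  by rewrite cards_draws sd.
rewrite -prodr_const.
apply: eq_big => [tau|tau /andP[/dim/andP[td _] /eqP <-]]; last by rewrite inordK.
apply/andP/idP.
  case=> tF /eqP <-; have /andP[td _] := dim _ tF.
  move: tF; rewrite !inE inordK//.
  by move=> /andP[-> t1]; rewrite prednK ?eqxx// ltnW.
rewrite inE => /andP[ts /eqP t1]; rewrite !inE ts t1 ltnS i1; split=> //.
by apply/eqP/val_inj; rewrite /= inordK.
Qed.

Lemma faces_potential (d n : nat) (s : {set 'I_n}) :
  s \in subsets n d -> faces s \subset potential_faces d n.
Proof.
rewrite inE => /eqP sd; apply/fintype.subsetP => tau.
rewrite !inE => /andP[ts ->] /=.
by rewrite (leq_trans (subset_leq_card ts))// sd.
Qed.

Lemma disjoint_faces (n : nat) (s t : {set 'I_n}) :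
  s :&: t = finset.set0 -> [disjoint faces s & faces t].
Proof.
move=> st0; rewrite -finset.setI_eq0; apply/eqP/finset.setP => tau.
rewrite !inE; apply/negP => /andP[/andP[taus tau1] /andP[taut _]].
have : tau \subset s :&: t by rewrite finset.subsetI taus.
by rewrite st0 finset.subset0 => /eqP tau0; rewrite tau0 cards0 in tau1.
Qed.

Lemma card_subsets_at (n d : nat) (v : 'I_n) :
  (#|[set s in subsets n d.+1 | v \in s]| <= 'C(n.-1, d))%N.
Proof.
have <- : #|[set~ v]| = n.-1 by rewrite cardsC1 card_ord.
rewrite -cards_draws.
apply: leq_trans (leq_imset_card (fun A => v |: A) _).
apply/subset_leq_card/fintype.subsetP => s; rewrite !inE => /andP[/eqP sd vs].
apply/imsetP; exists (s :\ v); last by rewrite finset.setD1K.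
rewrite inE; apply/andP; split.
  by apply/fintype.subsetP => x; rewrite !inE => /andP[].
by move: sd; rewrite (cardsD1 v s) vs add1n => -[->].
Qed.

Lemma leq_card_bigcup (I T : finType) (F : I -> {set T}) :
  (#|\bigcup_i F i| <= \sum_i #|F i|)%N.
Proof.
elim/big_rec2: _ => [|i m A _ Am]; first by rewrite cards0.
by apply: leq_trans (leq_card_setU _ _) _; rewrite leq_add2l.
Qed.

Definition meeting_pairs (n d : nat) : {set {set 'I_n} * {set 'I_n}} :=
  [set st in finset.setX (subsets n d) (subsets n d) |
     st.1 :&: st.2 != finset.set0].

(** A pair that meets has a common vertex, so there are at most
    n C(n-1, d-1)^2 of them, and n C(n-1, d-1) = d C(n, d). *)
Lemma card_meeting_pairs (n d : nat) :
  (#|meeting_pairs n d| * n <= (d * 'C(n, d)) ^ 2)%N.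
Proof.
rewrite /meeting_pairs; case: d => [|d].
  rewrite (_ : [set _ in _ | _] = finset.set0) ?cards0//.
  apply/finset.setP => -[s t]; rewrite !inE /=.
  apply/negP => /andP[/andP[/eqP/cards0_eq -> _]].
  by rewrite finset.set0I eqxx.
pose at_ (v : 'I_n) := [set s in subsets n d.+1 | v \in s].
have : (#|meeting_pairs n d.+1| <= n * 'C(n.-1, d) ^ 2)%N.
  apply: (@leq_trans #|\bigcup_(v : 'I_n) finset.setX (at_ v) (at_ v)|).
    apply/subset_leq_card/fintype.subsetP => -[s t]; rewrite !inE /=.
    move=> /andP[/andP[sd td] /set0Pn[v]]; rewrite inE => /andP[vs vt].
    by apply/bigcupP; exists v => //; rewrite !inE sd td vs vt.
  apply: leq_trans (leq_card_bigcup _) _.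
  rewrite -[X in (_ <= X * _)%N]card_ord -sum_nat_const; apply: leq_sum => v _.
  by rewrite finset.cardsX leq_mul// card_subsets_at.
move=> /(leq_mul (leqnn n)); rewrite mulnC => /leq_trans; apply.
by rewrite -mul_bin_diag expnMn mulnA mulnn.
Qed.

End Counting.

(** * The density of (d-1)-cells for a fixed number of vertices *)

Section FixedSize.
Context {R : realType} {d n : nat} {p : nat -> R}
  {dO : measure_display} {Omega : measurableType dO}
  {P : probability Omega R} (chi : {set 'I_n} -> {RV P >-> bool}).
Hypothesis d_gt0 : (0 < d)%N.
Hypothesis hp : forall k, (1 <= k <= d)%N -> 0 < p k <= 1.
Hypothesis hchi : bernoulli_face_family d p chi.
Local Open Scope classical_set_scope.

Definition present (s : {set 'I_n}) : set Omega :=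
  \bigcap_(tau in [set` faces s]) (chi tau @^-1` [set true]).

Definition density (w : Omega) : R :=
  #|cells d.-1 (Yd d (fun tau => chi tau w))|%:R / 'C(n, d)%:R.

Local Notation q := (\prod_(1 <= i < d) p i ^+ 'C(d, i.+1)).

Lemma measurable_present (s : {set 'I_n}) : measurable (present s).
Proof.
apply: fin_bigcap_measurable; first exact: finite_finset.
by move=> tau _; rewrite -[X in measurable X]setTI; exact: measurable_funP.
Qed.

Lemma card_cells_Yd (w : Omega) :
  #|cells d.-1 (Yd d (fun tau => chi tau w))|%:R =
    \sum_(s in subsets n d) \1_(present s) w :> R.
Proof.
under eq_bigr => s _ do rewrite indicE.
rewrite -natr_sum -big_mkcondr /= sum1_card; congr (_%:R).
apply: eq_card => s; rewrite !inE unfold_in prednK// inE.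
have [sd|] := eqVneq #|s| d; last by rewrite !andbF.
rewrite sd leqnSn andbT /=; apply/forallP/idP => [all1|].
  rewrite in_setE => tau /=; rewrite inE => tauF.
  by have /implyP := all1 tau; exact.
rewrite in_setE => all1 tau; apply/implyP => tauF; apply: all1 => /=.
by rewrite inE.
Qed.

Lemma measurable_density : measurable_fun setT density.
Proof.
apply: measurable_funM => //.
under eq_fun => w do rewrite card_cells_Yd -big_enum /=.
apply: measurable_sum => s; exact/measurable_indic/measurable_present.
Qed.

Lemma prob_all_retained (J : {set {set 'I_n}}) :
  J \subset potential_faces d n ->
  P (\bigcap_(tau in [set` J]) (chi tau @^-1` [set true])) =
    (\prod_(tau in J) p #|tau|.-1)%:E.
Proof.
case: hchi => indep law Jd; rewrite (indep J (fun=> [set true]))// -prodEFin.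
apply: eq_bigr => tau /(fintype.subsetP Jd) tauF.
have := law _ tauF [set true]; rewrite /distribution /pushforward => ->.
have tau_dim : (1 <= #|tau|.-1 <= d)%N.
  by move: tauF; rewrite inE; case: #|tau| => [|[|m]].
have /andP[p0 p1] := hp tau_dim.
by rewrite /bernoulli_prob (ltW p0) p1 fsbig_set1.
Qed.

Lemma prob_present (s : {set 'I_n}) : s \in subsets n d ->
  P (present s) = q%:E.
Proof.
by move=> sd; rewrite prob_all_retained ?faces_potential// (prod_faces _ sd).
Qed.

(** The two events are determined by disjoint subfamilies of the Bernoulli
    variables, since a face with two vertices cannot lie in both sets. *)
Lemma prob_presentI (s t : {set 'I_n}) :
  s \in subsets n d -> t \in subsets n d -> (s :&: t)%SET = finset.set0 ->
  P (present s `&` present t) = (q ^+ 2)%:E.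
Proof.
move=> sd td st0.
have -> : present s `&` present t =
    \bigcap_(tau in [set` (faces s :|: faces t)%SET]) (chi tau @^-1` [set true]).
  apply/seteqP; split => w.
    by move=> [ws wt] tau /=; rewrite finset.in_setU => /orP[/ws|/wt].
  move=> wst; split => tau /= tauF; apply: wst;
    by rewrite /= finset.in_setU tauF ?orbT.
rewrite prob_all_retained; last by rewrite finset.subUset !faces_potential.
rewrite (eq_bigl _ _ (fun tau => finset.in_setU tau (faces s) (faces t))).
by rewrite bigU ?disjoint_faces//= (prod_faces _ sd) (prod_faces _ td).
Qed.

Lemma density_deviation (eps : R) : (d <= n)%N -> 0 < eps ->
  (P [set w | (eps <= `|density w - q|)%R]
     <= (d%:R ^+ 2 / eps ^+ 2 * n%:R^-1)%:E)%E.
Proof.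
move=> dn eps0.
have N0 : 0 < 'C(n, d)%:R :> R by rewrite ltr0n bin_gt0.
have n0 : 0 < n%:R :> R by rewrite ltr0n (leq_trans d_gt0).
have := @chebyshev_count _ _ _ P _ (subsets n d) (meeting_pairs n d) present q
  (eps * 'C(n, d)%:R) measurable_present prob_present.
rewrite card_subsets.
have -> : [set w | eps * 'C(n, d)%:R <=
    `|\sum_(s in subsets n d) \1_(present s) w - 'C(n, d)%:R * q|] =
    [set w | eps <= `|density w - q|].
  apply/funext => w /=; congr (is_true _); rewrite -card_cells_Yd.
  rewrite -(ler_pM2r N0 eps) -[X in _ = (_ <= _ * X)](gtr0_norm N0) -normrM.
  by rewrite mulrBl divfK ?gt_eqF// [q * _]mulrC.
move=> cheb; apply: le_trans (cheb _ _) _.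
- move=> s t sd td; rewrite !inE /= in sd td *; rewrite sd td /= negbK => /eqP.
  by apply: prob_presentI; rewrite inE.
- by rewrite mulr_gt0.
rewrite lee_fin exprMn ler_pdivrMr ?mulr_gt0 ?exprn_gt0//.
rewrite [leRHS](_ : _ = (d%:R * 'C(n, d)%:R) ^+ 2 / n%:R); last first.
  by field; rewrite !gt_eqF.
rewrite ler_pdivlMr//.
by have := card_meeting_pairs n d; rewrite -(ler_nat R) natrX !natrM.
Qed.

End FixedSize.

(** * Convergence in probability *)

Theorem lemma21 (R : realType) (d : nat) (c : R) (p : nat -> nat -> R)
    (dO : nat -> measure_display)
    (Omega : forall n : nat, measurableType (dO n))
    (P : forall n : nat, probability (Omega n) R)
    (chi : forall n : nat, {set 'I_n} -> {RV (P n) >-> bool})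
    (hd : (2 <= d)%N) (hc : 0 < c)
    (hp : forall n k : nat, (1 <= k <= d)%N -> 0 < p n k <= 1)
    (hchi : forall n : nat, bernoulli_face_family d (p n) (chi n))
    (hDom : Dom d c p) :
  cvg_in_probability_to_cst P
    (fun n w => #|cells d.-1 (Yd d (fun tau => chi n tau w))|%:R / 'C(n, d)%:R)
    c.
Proof.
have d0 : (0 < d)%N by exact: ltnW.
move=> eps eps0; have eps2 : 0 < eps / 2 by rewrite divr_gt0.
case: hDom => _ _ /cvgrPdist_lt/(_ _ eps2) mean_near_c.
pose bound n : R := d%:R ^+ 2 / (eps / 2) ^+ 2 * n%:R^-1.
have bound0 : ((bound n)%:E @[n --> \oo] --> 0%E)%classic.
  apply: cvg_EFin; first by near=> n.
  rewrite -(mulr0 (d%:R ^+ 2 / (eps / 2) ^+ 2)); apply: cvgMl_tmp.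
  apply/gtr0_cvgV0; last exact: cvgr_idn.
  by near=> n; rewrite ltr0n; near: n; exists 1%N.
apply: (squeeze_cvge _ (@cvg_cst _ _ _ _ _) bound0).
near=> n; rewrite measure_ge0 /=.
pose X := @density R d n _ _ _ (chi n).
pose q := \prod_(1 <= i < d) p n i ^+ 'C(d, i.+1).
have mdist a : measurable_fun setT (fun w => `|X w - a|).
  apply: measurableT_comp => //; apply: measurable_funB => //.
  exact: measurable_density.
apply: (@le_trans _ _ (P n [set w | eps / 2 <= `|X w - q|]%classic)); last first.
  apply: density_deviation => //; first exact: hp.
  by near: n; exists d.
apply: le_measure.
- rewrite inE -[X in measurable X]setTI.
  rewrite (_ : mkset _ = (fun w => `|X w - c|) @^-1` `]eps, +oo[)%classic.
    exact: mdist.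
  by apply/seteqP; split=> w /=; rewrite in_itv /= andbT.
- rewrite inE -[X in measurable X]setTI.
  rewrite (_ : mkset _ = (fun w => `|X w - q|) @^-1` `[eps / 2, +oo[)%classic.
    exact: mdist.
  by apply/seteqP; split=> w /=; rewrite in_itv /= andbT.
move=> w /= far.
have near_mean : `|c - q| < eps / 2 by rewrite /q; near: n.
have := ler_distD q (X w) c; rewrite (distrC q c).
by rewrite -/(density _ _) -/X in far; lra.
Unshelve. all: by end_near.
Qed.
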